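(* Let $\mathcal{R}^\ast$ be the set of endomorphisms $R$ of $V\otimes V$ of six-vertex form satisfying $a_1a_2+b_1b_2=c_1c_2$ and $c_1c_2\neq0$. Then $\pi$ is injective on $\mathcal{R}^\ast$ and $\pi(\mathcal{R}^\ast)$ is a subgroup of $\mathrm{GL}(4,\mathbb{C})$, so that $\mathcal{R}^\ast$ carries a composition law $R\circ T$ determined by $\pi(R\circ T)=\pi(R)\pi(T)$; with this law $\mathcal{R}^\ast$ is a group isomorphic to $\mathrm{GL}(2,\mathbb{C})\times\mathrm{GL}(1,\mathbb{C})$, and for all $R,T\in\mathcal{R}^\ast$, setting $S=R\circ T$, one has $\llbracket R,S,T\rrbracket=0$.
   Context: Let $V$ be a two-dimensional complex vector space with basis $v_+,v_-$. Identify $\operatorname{End}(V\otimes V)$ with $4\times4$ matrices using the ordered basis $v_+\otimes v_+,\ v_+\otimes v_-,\ v_-\otimes v_+,\ v_-\otimes v_-$. An endomorphism is of six-vertex form if its matrix is $$R=\begin{pmatrix}a_1&0&0&0\\0&b_1&c_1&0\\0&c_2&b_2&0\\0&0&0&a_2\end{pmatrix},$$ with entries $a_1,\dots$ as displayed. Define $$\pi(R)=\begin{pmatrix}c_1&0&0&0\\0&a_1&b_2&0\\0&-b_1&a_2&0\\0&0&0&c_2\end{pmatrix}.$$ For $\phi\in\operatorname{End}(V\otimes V)$ define $\phi_{12},\phi_{13},\phi_{23}\in\operatorname{End}(V\otimes V\otimes V)$ by requiring, for $\phi=\phi'\otimes\phi''$, $\phi_{12}=\phi'\otimes\phi''\otimes1$,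 $\phi_{13}=\phi'\otimes1\otimes\phi''$, $\phi_{23}=1\otimes\phi'\otimes\phi''$, extended linearly; and $\llbracket\phi,\psi,\chi\rrbracket=\phi_{12}\psi_{13}\chi_{23}-\chi_{23}\psi_{13}\phi_{12}$. *)

(* Defs.v *)
From HB Require Import structures.
From mathcomp Require Import all_boot all_order all_algebra.
From mathcomp Require Import all_classical reals complex mxtens ring.

Set Implicit Arguments.
Unset Strict Implicit.
Unset Printing Implicit Defensive.

Import GRing.Theory.
Local Open Scope ring_scope.
Local Open Scope classical_set_scope.

Notation "A *t B" := (tensmx A B)
  (at level 40, left associativity, format "A  *t  B") : ring_scope.

(* The general linear group; MathComp's 'GL_n[R] requires R finite. *)
Section GeneralLinear.
Variables (F : fieldType) (n : nat).

Record GL := MkGL { GLval :> 'M[F]_n ; GLP : GLval \in unitmx }.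

HB.instance Definition _ := [isSub for GLval].
HB.instance Definition _ := [Choice of GL by <:].

Lemma GL_one_subproof : (1%:M : 'M[F]_n) \in unitmx.
Proof. exact: unitmx1. Qed.

Lemma GL_mul_subproof (g h : GL) : val g *m val h \in unitmx.
Proof. by rewrite unitmx_mul (GLP g) (GLP h). Qed.

Lemma GL_inv_subproof (g : GL) : invmx (val g) \in unitmx.
Proof. by rewrite unitmx_inv (GLP g). Qed.

Definition GL_one : GL := MkGL GL_one_subproof.
Definition GL_mul (g h : GL) : GL := MkGL (GL_mul_subproof g h).
Definition GL_inv (g : GL) : GL := MkGL (GL_inv_subproof g).

Lemma GL_mulA : associative GL_mul.
Proof. by move=> x y z; apply/val_inj; rewrite /= mulmxA. Qed.

Lemma GL_mul1 : left_id GL_one GL_mul.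
Proof. by move=> x; apply/val_inj; rewrite /= mul1mx. Qed.

Lemma GL_mulr1 : right_id GL_one GL_mul.
Proof. by move=> x; apply/val_inj; rewrite /= mulmx1. Qed.

Lemma GL_mulV : left_inverse GL_one GL_inv GL_mul.
Proof. by move=> x; apply/val_inj; rewrite /= mulVmx // (GLP x). Qed.

Lemma GL_mulrV : right_inverse GL_one GL_inv GL_mul.
Proof. by move=> x; apply/val_inj; rewrite /= mulmxV // (GLP x). Qed.

HB.instance Definition _ :=
  isGroup.Build GL GL_mulA GL_mul1 GL_mulr1 GL_mulV GL_mulrV.

Definition is_GL_subgroup (A : set 'M[F]_n) : Prop :=
  {subset A <= unitmx} /\ group_closed [pred g : GL | val g \in A].

End GeneralLinear.

Definition is_group_law (T : Type) (op : T -> T -> T) : Prop :=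
  exists (e : T) (inv : T -> T),
    [/\ associative op, left_id e op, right_id e op,
        left_inverse e inv op & right_inverse e inv op].

Definition law_isomorphic (T : Type) (op : T -> T -> T) (G : groupType) : Prop :=
  exists f : T -> G, bijective f /\ {morph f : x y / op x y >-> (x * y)%g}.

(* End(V (x) V) is 'M_(2 * 2) and End(V (x) V (x) V) is 'M_(2 * 2 * 2), matrices
   acting on columns; the index of v_s (x) v_t is mxtens_index (s, t) = 2 s + t
   with + = 0 and - = 1, which is the order ++, +-, -+, --. *)
Section Legs.
Variable F : fieldType.

(* The linear extension to End(V (x) V) of phi' (x) phi'' |-> Phi phi' phi'',
   for Phi bilinear: expand phi on the basis E_ij (x) E_kl. *)
Definition tens_extend (Phi : 'M[F]_2 -> 'M[F]_2 -> 'M[F]_(2 * 2 * 2))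
    (phi : 'M[F]_(2 * 2)) : 'M[F]_(2 * 2 * 2) :=
  \sum_(i < 2) \sum_(j < 2) \sum_(k < 2) \sum_(l < 2)
     phi (mxtens_index (i, k)) (mxtens_index (j, l))
       *: Phi (delta_mx i j) (delta_mx k l).

Definition leg12 := tens_extend (fun A B => A *t B *t (1%:M : 'M_2)).
Definition leg13 := tens_extend (fun A B => A *t (1%:M : 'M_2) *t B).
Definition leg23 := tens_extend (fun A B => (1%:M : 'M_2) *t A *t B).

Definition yb_bracket (phi psi chi : 'M[F]_(2 * 2)) : 'M[F]_(2 * 2 * 2) :=
  leg12 phi *m leg13 psi *m leg23 chi - leg23 chi *m leg13 psi *m leg12 phi.

Lemma tens_extend_linear Phi : linear (tens_extend Phi).
Proof.
move=> a p q; rewrite /tens_extend scaler_sumr -big_split; apply: eq_bigr => i _.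
rewrite scaler_sumr -big_split; apply: eq_bigr => j _.
rewrite scaler_sumr -big_split; apply: eq_bigr => k _.
rewrite scaler_sumr -big_split; apply: eq_bigr => l _.
by rewrite !mxE scalerDl scalerA.
Qed.

Lemma tens_extend_tens (Phi : 'M[F]_2 -> 'M[F]_2 -> 'M[F]_(2 * 2 * 2)) A B :
  (forall C, linear (Phi C)) -> (forall C, linear (Phi^~ C)) ->
  tens_extend Phi (A *t B) = Phi A B.
Proof.
move=> Lr Ll.
have sumE (f : 'M[F]_2 -> 'M[F]_(2 * 2 * 2)) (M : 'M[F]_2) : linear f ->
    f M = \sum_i \sum_j M i j *: f (delta_mx i j).
  move=> lf; pose g : {linear 'M[F]_2 -> 'M[F]_(2 * 2 * 2)} :=
    HB.pack f (GRing.isLinear.Build _ _ _ _ f lf).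
  rewrite -[f]/(g : _ -> _) {1}[M]matrix_sum_delta linear_sum.
  by apply: eq_bigr => i _; rewrite linear_sum; apply: eq_bigr => j _; rewrite linearZ.
rewrite (sumE (Phi^~ B) A) //; apply: eq_bigr => i _; apply: eq_bigr => j _.
rewrite (sumE (Phi _) B) // scaler_sumr; apply: eq_bigr => k _.
by rewrite scaler_sumr; apply: eq_bigr => l _; rewrite tensmxE scalerA.
Qed.

Lemma leg12_tens (A B : 'M[F]_2) : leg12 (A *t B) = A *t B *t (1%:M : 'M_2).
Proof.
by apply: (tens_extend_tens (Phi := fun A B => A *t B *t (1%:M : 'M_2))) => C a X Y;
   apply/matrixP => i j; rewrite !mxE; ring.
Qed.

Lemma leg13_tens (A B : 'M[F]_2) : leg13 (A *t B) = A *t (1%:M : 'M_2) *t B.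
Proof.
by apply: (tens_extend_tens (Phi := fun A B => A *t (1%:M : 'M_2) *t B)) => C a X Y;
   apply/matrixP => i j; rewrite !mxE; ring.
Qed.

Lemma leg23_tens (A B : 'M[F]_2) : leg23 (A *t B) = (1%:M : 'M_2) *t A *t B.
Proof.
by apply: (tens_extend_tens (Phi := fun A B => (1%:M : 'M_2) *t A *t B)) => C a X Y;
   apply/matrixP => i j; rewrite !mxE; ring.
Qed.

End Legs.

Section SixVertex.
Variable F : fieldType.

Definition mx4 (rows : seq (seq F)) : 'M[F]_4 :=
  \matrix_(i < 4, j < 4) nth 0 (nth [::] rows i) j.

Definition sixvertex_mx (a1 a2 b1 b2 c1 c2 : F) : 'M[F]_4 :=
  mx4 [:: [:: a1; 0;  0;  0 ];
          [:: 0;  b1; c1; 0 ];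
          [:: 0;  c2; b2; 0 ];
          [:: 0;  0;  0;  a2]].

(* Reads off the six entries of sixvertex_mx by position; the value on matrices
   not of six-vertex form is irrelevant. *)
Definition sixvertex_pi (M : 'M[F]_4) : 'M[F]_4 :=
  let a1 := M (inord 0) (inord 0) in
  let b1 := M (inord 1) (inord 1) in
  let c1 := M (inord 1) (inord 2) in
  let c2 := M (inord 2) (inord 1) in
  let b2 := M (inord 2) (inord 2) in
  let a2 := M (inord 3) (inord 3) in
  mx4 [:: [:: c1; 0;    0;  0 ];
          [:: 0;  a1;   b2; 0 ];
          [:: 0;  - b1; a2; 0 ];
          [:: 0;  0;    0;  c2]].

Lemma sixvertex_piE a1 a2 b1 b2 c1 c2 :
  sixvertex_pi (sixvertex_mx a1 a2 b1 b2 c1 c2) =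
  mx4 [:: [:: c1; 0;    0;  0 ];
          [:: 0;  a1;   b2; 0 ];
          [:: 0;  - b1; a2; 0 ];
          [:: 0;  0;    0;  c2]].
Proof. by rewrite /sixvertex_pi !mxE !inordK. Qed.

Definition Rstar : set 'M[F]_4 :=
  [set M | exists a1 a2 b1 b2 c1 c2 : F,
     [/\ M = sixvertex_mx a1 a2 b1 b2 c1 c2,
         a1 * a2 + b1 * b2 = c1 * c2 & c1 * c2 != 0]].

(* Through set_type, Rstar : set _ also stands for the type of its elements. *)
Definition is_composition (op : Rstar -> Rstar -> Rstar) : Prop :=
  forall r t : Rstar,
    sixvertex_pi (val (op r t)) = sixvertex_pi (val r) *m sixvertex_pi (val t).

End SixVertex.
Arguments Rstar : clear implicits.

(* Main.v *)
Require Import Defs.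
From HB Require Import structures.
From mathcomp Require Import all_boot all_order all_algebra.
From mathcomp Require Import all_classical reals complex mxtens ring.

(** An element of [Rstar] amounts to a pair [(A, c)] with [A] in GL(2) and
    [c] in GL(1): [A] is the middle block of its image under [sixvertex_pi], and
    [c = c1]; the free-fermion equation says [det A = c1 c2], so that [c2] is
    forced. As [det] is multiplicative, the block matrices
    [diag (c, A, det A / c)] multiply like the pairs [(A, c)], which gives the
    group structure and the isomorphism. The entries of the Yang-Baxter bracket
    are differences of two state sums over three inner edges, and each difference
    vanishes modulo the two free-fermion equations. *)

Set Implicit Arguments.
Unset Strict Implicit.
Unset Printing Implicit Defensive.

Import GRing.Theory.
Local Open Scope ring_scope.
Local Open Scope classical_set_scope.

(** * Entries of the legs and of the Yang-Baxter bracket *)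

Local Notation idx i j := (mxtens_index (i, j)).

Lemma big_mxtens_index (V : nmodType) (m n : nat) (f : 'I_(m * n) -> V) :
  \sum_k f k = \sum_i \sum_j f (idx i j).
Proof.
rewrite pair_big /= (reindex (@mxtens_index m n)) /=; first by apply: eq_bigr => -[].
by exists (@mxtens_unindex m n) => i _; rewrite (mxtens_indexK, mxtens_unindexK).
Qed.

Lemma mulmx_mxtensE (S : pzSemiRingType) (m n p q r : nat)
    (M : 'M[S]_(q, m * n * p)) (N : 'M[S]_(m * n * p, r)) x y :
  (M *m N) x y = \sum_i \sum_j \sum_k
    M x (idx (idx i j) k) * N (idx (idx i j) k) y.
Proof. by rewrite mxE big_mxtens_index big_mxtens_index. Qed.

(** Used mostly from right to left: it inserts a sum over a Kronecker delta, so that two sums can be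
    compared term by term. *)
Lemma sumr_delta (S : pzSemiRingType) (n : nat) (f : 'I_n -> S) (x : 'I_n) :
  \sum_i f i * (x == i)%:R = f x.
Proof.
rewrite (bigD1 x) //= eqxx mulr1 big1 ?addr0 // => i.
by rewrite eq_sym => /negbTE ->; rewrite mulr0.
Qed.

(** The four deltas select a single term of the fourfold sum; [e] is the entry of the identity on
    the idle tensor factor. *)
Lemma tens_extendE (F : fieldType)
    (Phi : 'M[F]_2 -> 'M[F]_2 -> 'M[F]_(2 * 2 * 2)) (phi : 'M[F]_(2 * 2))
    (i j k l : 'I_2) (e : F) x y :
  (forall i' j' k' l', Phi (delta_mx i' j') (delta_mx k' l') x y =
     (i == i')%:R * (j == j')%:R * (k == k')%:R * (l == l')%:R * e) ->
  tens_extend Phi phi x y = phi (idx i k) (idx j l) * e.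
Proof.
move=> PhiE; rewrite /tens_extend summxE.
rewrite -[RHS](sumr_delta
  (fun i' => phi (idx i' k) (idx j l) * e)).
apply: eq_bigr => i' _; rewrite summxE.
rewrite -[RHS](sumr_delta
  (fun j' => phi (idx i' k) (idx j' l) * e * (i == i')%:R)).
apply: eq_bigr => j' _; rewrite summxE.
rewrite -[RHS](sumr_delta
  (fun k' => phi (idx i' k') (idx j' l) * e * (i == i')%:R
             * (j == j')%:R)).
apply: eq_bigr => k' _; rewrite summxE.
rewrite -[RHS](sumr_delta
  (fun l' => phi (idx i' k') (idx j' l') * e * (i == i')%:R
             * (j == j')%:R * (k == k')%:R)).
by apply: eq_bigr => l' _; rewrite mxE PhiE; ring.
Qed.

Section LegEntries.
Variables (F : fieldType) (phi : 'M[F]_(2 * 2)) (i j k i' j' k' : 'I_2).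
Let x := idx (idx i j) k.
Let y := idx (idx i' j') k'.

Lemma leg12E : leg12 phi x y =
  phi (idx i j) (idx i' j') * (k == k')%:R.
Proof.
by apply: tens_extendE => p q r s; rewrite /x /y !tensmxE !mxE -!natrM !mulnb !andbA.
Qed.

Lemma leg13E : leg13 phi x y =
  phi (idx i k) (idx i' k') * (j == j')%:R.
Proof.
apply: tens_extendE => p q r s; rewrite /x /y !tensmxE !mxE -!natrM !mulnb.
by rewrite -!andbA [(j == j') && _]andbC -!andbA.
Qed.

Lemma leg23E : leg23 phi x y =
  phi (idx j k) (idx j' k') * (i == i')%:R.
Proof.
apply: tens_extendE => p q r s; rewrite /x /y !tensmxE !mxE -!natrM !mulnb.
by rewrite -!andbA andbC -!andbA.
Qed.

End LegEntries.

Section LegProducts.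
Variables (F : fieldType) (phi psi chi : 'M[F]_(2 * 2)).
Variables (i j k i' j' k' : 'I_2).
Let x := idx (idx i j) k.
Let y := idx (idx i' j') k'.

(** The legs share only the first tensor factor. Each is the identity on one of the other two, so
    one inner index survives. *)
Lemma leg12_mul_leg13E : (leg12 phi *m leg13 psi) x y =
  \sum_p phi (idx i j) (idx p j') * psi (idx p k) (idx i' k').
Proof.
rewrite mulmx_mxtensE; apply: eq_bigr => p _.
rewrite -[RHS](sumr_delta
  (fun q => phi (idx i j) (idx p q) * psi (idx p k) (idx i' k'))).
apply: eq_bigr => q _; rewrite -[RHS](sumr_delta
  (fun r => phi (idx i j) (idx p q) * psi (idx p r) (idx i' k') * (j' == q)%:R)).
by apply: eq_bigr => r _; rewrite leg12E leg13E (eq_sym q); ring.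
Qed.

(** Here the shared factor is the third, whose inner index is [r]. *)
Lemma leg23_mul_leg13E : (leg23 chi *m leg13 psi) x y =
  \sum_r chi (idx j k) (idx j' r) * psi (idx i r) (idx i' k').
Proof.
rewrite mulmx_mxtensE -[RHS](sumr_delta
  (fun p => \sum_r chi (idx j k) (idx j' r) * psi (idx p r) (idx i' k'))).
apply: eq_bigr => p _; rewrite -[RHS](sumr_delta (fun q =>
  (\sum_r chi (idx j k) (idx q r) * psi (idx p r) (idx i' k')) * (i == p)%:R)).
apply: eq_bigr => q _; rewrite !mulr_suml; apply: eq_bigr => r _.
by rewrite leg23E leg13E (eq_sym q); ring.
Qed.

End LegProducts.

Section StateSums.
Variables (F : fieldType) (phi psi chi : 'M[F]_(2 * 2)).
Variables (i j k i' j' k' : 'I_2).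
Let x := idx (idx i j) k.
Let y := idx (idx i' j') k'.

(** The third leg is the identity on one factor; its delta removes one more index and leaves three
    inner edges in each product. *)
Lemma yb_bracketE : yb_bracket phi psi chi x y =
  \sum_q \sum_r (\sum_p phi (idx i j) (idx p q) * psi (idx p k) (idx i' r)) *
    chi (idx q r) (idx j' k') -
  \sum_p \sum_q (\sum_r chi (idx j k) (idx q r) * psi (idx i r) (idx p k')) *
    phi (idx p q) (idx i' j').
Proof.
rewrite /yb_bracket mxE [X in _ + X]mxE !mulmx_mxtensE; congr (_ - _).
  rewrite -[RHS](sumr_delta (fun s => \sum_q \sum_r
    (\sum_p phi (idx i j) (idx p q) * psi (idx p k) (idx s r)) *
    chi (idx q r) (idx j' k'))).
  apply: eq_bigr => s _; rewrite mulr_suml; apply: eq_bigr => q _.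
  rewrite mulr_suml; apply: eq_bigr => r _.
  by rewrite leg12_mul_leg13E leg23E mulrA (eq_sym s).
apply: eq_bigr => p _; apply: eq_bigr => q _.
rewrite -[RHS](sumr_delta (fun s =>
  (\sum_r chi (idx j k) (idx q r) * psi (idx i r) (idx p s)) *
  phi (idx p q) (idx i' j'))).
by apply: eq_bigr => s _; rewrite leg23_mul_leg13E leg12E mulrA (eq_sym s).
Qed.

End StateSums.

(** * The Yang-Baxter equation for free-fermionic weights *)

Lemma mx4E (F : fieldType) (rows : seq (seq F)) (x y : 'I_4) :
  mx4 rows x y = nth 0 (nth [::] rows x) y.
Proof. by rewrite mxE. Qed.

(** The weights of the middle matrix are read off from the product of the images of the outer two
    under [sixvertex_pi]. *)
Lemma yb_bracket_sixvertex (F : fieldType)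
    (a1 a2 b1 b2 c1 c2 a1' a2' b1' b2' c1' c2' : F) :
  a1 * a2 + b1 * b2 = c1 * c2 -> a1' * a2' + b1' * b2' = c1' * c2' ->
  yb_bracket (sixvertex_mx a1 a2 b1 b2 c1 c2)
    (sixvertex_mx (a1 * a1' - b2 * b1') (a2 * a2' - b1 * b2')
       (b1 * a1' + a2 * b1') (a1 * b2' + b2 * a2') (c1 * c1') (c2 * c2'))
    (sixvertex_mx a1' a2' b1' b2' c1' c2') = 0.
Proof.
(* As rewriting rules for [ring], the equations need a monomial on the left: [c1 * c2] is to be
   eliminated. *)
move=> /esym h /esym h'.
apply/matrixP => x y.
case: (mxtens_indexP x) => {x} x k; case: (mxtens_indexP x) => {x} i j.
case: (mxtens_indexP y) => {y} y k'; case: (mxtens_indexP y) => {y} i' j'.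
rewrite yb_bracketE /sixvertex_mx [RHS]mxE !big_ord_recl !big_ord0.
rewrite !mx4E.
(* Each of the 64 entries becomes a polynomial identity modulo [h] and [h']. *)
case: i => -[|[|//]] pi; case: j => -[|[|//]] pj; case: k => -[|[|//]] pk;
case: i' => -[|[|//]] pi'; case: j' => -[|[|//]] pj'; case: k' => -[|[|//]] pk';
rewrite /=; ring: h h'.
Qed.

(** * Parametrization by GL(2) and GL(1), and the image of [sixvertex_pi] *)

Section Parametrization.
Variable F : fieldType.
Implicit Types (A B : 'M[F]_2) (c d : F).

Lemma mulmx2E A B i j : (A *m B) i j = A i 0 * B 0 j + A i 1 * B 1 j.
Proof.
rewrite mxE !big_ord_recl big_ord0 addr0.
by congr (A i _ * B _ j + A i _ * B _ j); apply/val_inj.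
Qed.

Lemma det_mx22 A : \det A = A 0 0 * A 1 1 - A 0 1 * A 1 0.
Proof.
rewrite (expand_det_row A 0) !big_ord_recl big_ord0 addr0 /cofactor !det_mx11.
rewrite !mxE /= expr0 expr1 mul1r mulN1r mulrN.
by congr (_ * A _ _ - A _ _ * A _ _); apply/val_inj.
Qed.

(** The sign of [A 1 0] cancels the one in [sixvertex_pi], so that [A] itself is the middle block of
    the image. *)
Definition sixvertex_of A c : 'M[F]_4 :=
  sixvertex_mx (A 0 0) (A 1 1) (- A 1 0) (A 0 1) c (\det A / c).

Lemma sixvertex_of_Rstar A c :
  A \in unitmx -> c != 0 -> Rstar F (sixvertex_of A c).
Proof.
rewrite unitmxE unitfE => dA c0; exists (A 0 0), (A 1 1), (- A 1 0), (A 0 1), c.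
by exists (\det A / c); split; rewrite // [c * _]mulrC divfK // det_mx22; ring.
Qed.

Lemma RstarP (M : 'M[F]_4) : Rstar F M ->
  exists A c, [/\ A \in unitmx, c != 0 & M = sixvertex_of A c].
Proof.
move=> [a1 [a2 [b1 [b2 [c1 [c2 [-> h]]]]]]]; rewrite mulf_eq0 => /norP[c10 c20].
pose A : 'M[F]_2 := \matrix_(i, j) (if i == 0 then if j == 0 then a1 else b2
                                    else if j == 0 then - b1 else a2).
have dA : \det A = c1 * c2 by rewrite det_mx22 !mxE /= -h; ring.
exists A, c1; split; rewrite // ?unitmxE ?dA ?unitfE ?mulf_neq0 //.
by rewrite /sixvertex_of dA !mxE /= opprK [c1 * c2]mulrC mulfK.
Qed.

Definition block_of A c : 'M[F]_4 :=
  mx4 [:: [:: c; 0;     0;     0];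
          [:: 0; A 0 0; A 0 1; 0];
          [:: 0; A 1 0; A 1 1; 0];
          [:: 0; 0;     0;     \det A / c]].

Lemma sixvertex_pi_of A c : sixvertex_pi (sixvertex_of A c) = block_of A c.
Proof. by rewrite sixvertex_piE opprK. Qed.

Lemma ord2_cases (P : 'I_2 -> Prop) : P 0 -> P 1 -> forall i, P i.
Proof.
by move=> P0 P1 [[|[|//]] lti]; [move: P0 | move: P1]; congr P; apply/val_inj.
Qed.

Lemma block_of_inj A c B d : block_of A c = block_of B d -> A = B /\ c = d.
Proof.
move=> /matrixP E.
(* The first corner and the middle block suffice, since the last corner is a function of them. *)
have := (E (inord 0) (inord 0), E (inord 1) (inord 1), E (inord 1) (inord 2),
         E (inord 2) (inord 1), E (inord 2) (inord 2)).
rewrite !mx4E !inordK //= => -[[[[-> E00] E01] E10] E11]; split=> //.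
by apply/matrixP; apply: ord2_cases; apply: ord2_cases.
Qed.

Lemma block_of1 : block_of 1%:M 1 = 1%:M.
Proof.
apply/matrixP => i j; rewrite mx4E !mxE det1 divr1.
by case: i => -[|[|[|[|//]]]] ?; case: j => -[|[|[|[|//]]]] ?.
Qed.

Lemma block_of_mul A c B d :
  block_of A c *m block_of B d = block_of (A *m B) (c * d).
Proof.
apply/matrixP => i j.
rewrite mxE !big_ord_recl big_ord0 !mx4E !mulmx2E det_mulmx invfM.
by case: i => -[|[|[|[|//]]]] ?; case: j => -[|[|[|[|//]]]] ? /=; ring.
Qed.

(** A right inverse lies in the same family, at the inverse parameters. *)
Lemma block_of_unit A c : A \in unitmx -> c != 0 -> block_of A c \in unitmx.
Proof.
move=> uA c0.
have /mulmx1_unit[] // : block_of A c *m block_of (invmx A) c^-1 = 1%:M.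
by rewrite block_of_mul mulmxV // divff // block_of1.
Qed.

Lemma block_of_inv A c : A \in unitmx -> c != 0 ->
  invmx (block_of A c) = block_of (invmx A) c^-1.
Proof.
move=> uA c0; have uM := block_of_unit uA c0.
apply: (can_inj (mulKmx uM)).
by rewrite mulmxV // block_of_mul mulmxV // divff // block_of1.
Qed.

Lemma sixvertex_pi_inj : {in Rstar F &, injective (@sixvertex_pi F)}.
Proof.
move=> M N /set_mem/RstarP[A [c [_ _ ->]]] /set_mem/RstarP[B [d [_ _ ->]]].
by rewrite !sixvertex_pi_of => /block_of_inj[-> ->].
Qed.

Lemma image_sixvertex_piP (N : 'M[F]_4) :
  (@sixvertex_pi F @` Rstar F) N <->
  exists A c, [/\ A \in unitmx, c != 0 & N = block_of A c].
Proof.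
split=> [[_ /RstarP[A [c [uA c0 ->]]] <-]|[A [c [uA c0 ->]]]].
  by exists A, c; rewrite sixvertex_pi_of.
by exists (sixvertex_of A c); [exact: sixvertex_of_Rstar | exact: sixvertex_pi_of].
Qed.

Lemma sixvertex_pi_subgroup : is_GL_subgroup (@sixvertex_pi F @` Rstar F).
Proof.
split=> [N /set_mem/image_sixvertex_piP[A [c [uA c0 ->]]]|].
  exact: block_of_unit.
(* [group_closed] asks for the unit and for closure under division. *)
split=> [|g h].
  apply/mem_set/image_sixvertex_piP; exists 1%:M, 1.
  by rewrite unitmx1 oner_neq0 block_of1.
move=> /set_mem/image_sixvertex_piP[A [c [uA c0 gE]]].
move=> /set_mem/image_sixvertex_piP[B [d [uB d0 hE]]].
apply/mem_set/image_sixvertex_piP; exists (A *m invmx B), (c / d).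
rewrite unitmx_mul unitmx_inv uA uB mulf_neq0 ?invr_eq0 //; split=> //.
by rewrite -block_of_mul -block_of_inv // -gE -hE.
Qed.

(** * Transport of the group structure to [Rstar] *)

Lemma GL1_neq0 (u : GL F 1) : val u 0 0 != 0.
Proof. by rewrite -unitfE -det_mx11 -unitmxE (GLP u). Qed.

Definition Rstar_of_GL (g : GL F 2 * GL F 1) : Rstar F :=
  SigSub (mem_set (sixvertex_of_Rstar (GLP g.1) (GL1_neq0 g.2))).

Lemma Rstar_of_GL_pi g :
  sixvertex_pi (val (Rstar_of_GL g)) = block_of (val g.1) (val g.2 0 0).
Proof. exact: sixvertex_pi_of. Qed.

Lemma Rstar_pi_inj (r t : Rstar F) :
  sixvertex_pi (val r) = sixvertex_pi (val t) -> r = t.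
Proof. by move=> /sixvertex_pi_inj E; apply/val_inj/E; apply: valP. Qed.

Lemma Rstar_of_GL_inj : injective Rstar_of_GL.
Proof.
move=> [g u] [h v] /(congr1 (fun r => sixvertex_pi (val r))).
rewrite !Rstar_of_GL_pi => /block_of_inj[/= gh uv].
congr (_, _); apply/val_inj => //; apply/matrixP => i j.
by rewrite !ord1.
Qed.

Lemma Rstar_of_GL_surj (r : Rstar F) : exists g, Rstar_of_GL g = r.
Proof.
have [A [c [uA c0 rE]]] := RstarP (set_valP r).
have uc : (c%:M : 'M[F]_1) \in unitmx by rewrite unitmxE det_scalar1 unitfE.
exists (MkGL uA, MkGL uc); apply/Rstar_pi_inj.
by rewrite Rstar_of_GL_pi rE sixvertex_pi_of /= !mxE eqxx mulr1n.
Qed.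

(** Membership in [Rstar] only asserts that weights exist, so the inverse is obtained by choice from
    surjectivity. *)
Definition GL_of_Rstar (r : Rstar F) := sval (cid (Rstar_of_GL_surj r)).

Lemma GL_of_RstarK : cancel GL_of_Rstar Rstar_of_GL.
Proof. by move=> r; rewrite /GL_of_Rstar; case: cid. Qed.

Lemma Rstar_of_GLK : cancel Rstar_of_GL GL_of_Rstar.
Proof. by move=> g; apply/Rstar_of_GL_inj; rewrite GL_of_RstarK. Qed.

(** Defined by transport along the bijection, the law inherits the group axioms and the isomorphism;
    its relation to [sixvertex_pi] is then proved from [block_of_mul]. *)
Definition Rstar_mul (r t : Rstar F) : Rstar F :=
  Rstar_of_GL (GL_of_Rstar r * GL_of_Rstar t)%g.

Lemma Rstar_mul_composition : is_composition Rstar_mul.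
Proof.
move=> r t; rewrite /Rstar_mul -{2}(GL_of_RstarK r) -{2}(GL_of_RstarK t).
rewrite !Rstar_of_GL_pi block_of_mul; congr block_of.
(* What remains is that 1 by 1 matrices multiply like their entries. *)
by rewrite [LHS]mxE big_ord1.
Qed.

Lemma Rstar_mul_group : is_group_law Rstar_mul.
Proof.
exists (Rstar_of_GL 1%g), (fun r => Rstar_of_GL (GL_of_Rstar r)^-1%g).
split=> [r s t|r|r|r|r]; rewrite /Rstar_mul !Rstar_of_GLK.
- by rewrite mulgA.
- by rewrite mul1g GL_of_RstarK.
- by rewrite mulg1 GL_of_RstarK.
- by rewrite mulVg.
- by rewrite mulgV.
Qed.

Lemma Rstar_mul_isomorphic : law_isomorphic Rstar_mul (GL F 2 * GL F 1)%type.
Proof.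
exists GL_of_Rstar; split.
  by exists Rstar_of_GL; [exact: GL_of_RstarK | exact: Rstar_of_GLK].
by move=> r t; rewrite /Rstar_mul Rstar_of_GLK.
Qed.

Lemma Rstar_mul_yb (r t : Rstar F) :
  yb_bracket (val r) (val (Rstar_mul r t)) (val t) = 0.
Proof.
have [A [c [uA c0 rE]]] := RstarP (set_valP r).
have [B [d [uB d0 tE]]] := RstarP (set_valP t).
(* Both sides lie in [Rstar], so it is enough to compare their images under [sixvertex_pi]. *)
have -> : val (Rstar_mul r t) = sixvertex_of (A *m B) (c * d).
  apply: sixvertex_pi_inj; first exact: valP.
    by apply/mem_set/sixvertex_of_Rstar; rewrite ?unitmx_mul ?uA ?mulf_neq0.
  by rewrite Rstar_mul_composition rE tE !sixvertex_pi_of block_of_mul.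
(* The composite in the shape of [yb_bracket_sixvertex], with [a1], [a2], [b1], [b2] equal to
   [A 0 0], [A 1 1], [- A 1 0], [A 0 1], and likewise for [B]. *)
have ->: sixvertex_of (A *m B) (c * d) = sixvertex_mx
    (A 0 0 * B 0 0 - A 0 1 * - B 1 0) (A 1 1 * B 1 1 - - A 1 0 * B 0 1)
    (- A 1 0 * B 0 0 + A 1 1 * - B 1 0) (A 0 0 * B 0 1 + A 0 1 * B 1 1)
    (c * d) (\det A / c * (\det B / d)).
  by congr sixvertex_mx; rewrite ?mulmx2E ?det_mulmx ?invfM; ring.
rewrite rE tE /sixvertex_of.
by apply: yb_bracket_sixvertex; rewrite [RHS]mulrC divfK // det_mx22; ring.
Qed.

End Parametrization.

Theorem theorem3 (R : realType) :
  [/\ {in Rstar R[i] &, injective (@sixvertex_pi R[i])},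
      is_GL_subgroup (@sixvertex_pi R[i] @` Rstar R[i]) &
      exists op : Rstar R[i] -> Rstar R[i] -> Rstar R[i],
        [/\ unique (@is_composition R[i]) op,
            is_group_law op,
            law_isomorphic op (GL R[i] 2 * GL R[i] 1)%type &
            forall r t : Rstar R[i],
              yb_bracket (val r) (val (op r t)) (val t) = 0]].
Proof.
split; [exact: sixvertex_pi_inj | exact: sixvertex_pi_subgroup |].
exists (@Rstar_mul R[i]); split.
(* Uniqueness: as [sixvertex_pi] is injective on [Rstar], the image of a product determines the
   product. *)
- split=> [|op opE]; first exact: Rstar_mul_composition.
  apply/funext => r; apply/funext => t; apply/Rstar_pi_inj.
  by rewrite Rstar_mul_composition opE.
- exact: Rstar_mul_group.
- exact: Rstar_mul_isomorphic.
- exact: Rstar_mul_yb.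
Qed.
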